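(* In multihop Peg Duotaire, let $P\subseteq\{0,1\}^*$ be the set of words $w$ such that the position $w$ is a $\mathcal{P}$-position, and let $N=\{0,1\}^*\setminus P$ be the set of words whose position is an $\mathcal{N}$-position. Then neither $P$ nor $N$ is a regular language, and neither is a context-free language.
   Context: Peg Duotaire is an impartial two-player game played on the infinite line of sites indexed by $\mathbb{Z}$, each site holding a peg or being a hole, with finitely many pegs. A word $w\in\{0,1\}^*$ denotes the position in which $w$ is written on consecutive sites ($1$ = peg, $0$ = hole) and all other sites are holes. A hop: for a peg at site $i$, a peg at site $i+d$ and a hole at site $i+2d$ ($d=\pm1$), move the peg from $i$ to $i+2d$ and remove the peg at $i+d$. In the multihop version, a move is a sequence of one or more hops all performed by the same peg. Players alternate moves; a player unable to move loses. A $\mathcal{P}$-position is one from which the player who just moved (the second player) has a winning strategy, equivalently nim-value $0$; an $\mathcal{N}$-position is one from which the player to move wins, equivalently nonzero nim-value. *)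

(* Defs.v *)
From mathcomp Require Import all_boot all_algebra.
Set Implicit Arguments. Unset Strict Implicit. Unset Printing Implicit Defensive.
Import GRing.Theory Num.Theory.
Local Open Scope ring_scope.

(* A board: for each site in Z, whether it holds a peg. *)
Definition board := int -> bool.

Definition hop (p : board) (i d : int) (q : board) : Prop :=
  (d = 1 \/ d = -1) /\ p i /\ p (i + d) /\ ~~ p (i + d *+ 2) /\
  forall j : int, q j = (if j == i + d *+ 2 then true
                         else if (j == i) || (j == i + d) then false
                         else p j).

Inductive mhop : board -> int -> board -> Prop :=
| mhop1 p i d q : hop p i d q -> mhop p i q
| mhopS p i d p' q : hop p i d p' -> mhop p' (i + d *+ 2) q -> mhop p i q.

Definition move (p q : board) : Prop := exists i, mhop p i q.

(* P-positions (second player wins): every move leads to a position from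
   which the player to move can move to a P-position.  The game is finite
   (each hop removes a peg), so this inductive characterization coincides
   with the game-theoretic one. *)
Inductive Ppos : board -> Prop :=
| Ppos_intro p :
    (forall q, move p q -> exists r, move q r /\ Ppos r) -> Ppos p.

(* The position denoted by a word w: w written on sites 0..|w|-1, holes
   elsewhere (the game is translation invariant). *)
Definition board_of_word (w : seq bool) : board :=
  fun j => (0 <= j) && nth false w `|j|%N.

Definition language := seq bool -> Prop.

Definition Plang : language := fun w => Ppos (board_of_word w).
Definition Nlang : language := fun w => ~ Plang w.

Definition regular (L : language) : Prop :=
  exists (S : finType) (s0 : S) (delta : S -> bool -> S) (F : pred S),
    forall w, L w <-> F (foldl delta s0 w).

Record cfg := CFG {
  nonterm : finType;
  cfg_start : nonterm;
  cfg_rules : seq (nonterm * seq (nonterm + bool))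
}.

Unset Implicit Arguments.
Inductive gen (G : cfg) : nonterm G -> seq bool -> Prop :=
| gen_rule A rhs w : (A, rhs) \in cfg_rules G -> gen_seq G rhs w -> gen G A w
with gen_seq (G : cfg) : seq (nonterm G + bool) -> seq bool -> Prop :=
| gen_nil : gen_seq G [::] [::]
| gen_term b s w : gen_seq G s w -> gen_seq G (inr b :: s) (b :: w)
| gen_nonterm A s u w : gen G A u -> gen_seq G s w -> gen_seq G (inl A :: s) (u ++ w).

Set Implicit Arguments.

Definition context_free (L : language) : Prop :=
  exists G : cfg, forall w, L w <-> gen G (cfg_start G) w.

(* Main.v *)
Require Import Defs.
From mathcomp Require Import all_boot all_order all_algebra boolp zify ring.
Set Implicit Arguments. Unset Strict Implicit. Unset Printing Implicit Defensive.
Import GRing.Theory Num.Theory Order.TTheory.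

(** In the word 1(10)^n the first peg can hop 1, ..., n times to the right, and
    the only other move, the second peg hopping left, kills the position.  So the
    word is a Nim heap of size n, and 1(10)^a 00 1(10)^b 00 1(10)^c is the Nim
    position (a, b, c).  On the line (n, 2n, 3n) it is a P-position iff n has no
    two adjacent binary ones.

    If a context-free language contains the words with parameters (n, 2n, 3n) for
    all n = f(k), annotate their derivation trees with the states of an automaton
    that counts a, b and c.  Kruskal's theorem embeds the tree of some f(i) into
    that of a later f(j), and iterating the inserted contexts yields the words for
    all n = f(i) + m(f(j) - f(i)).  For P, take f(k) = 2^k and m = 2; for N, take
    f(k) = 3 * 4^k and choose m so that n = 4^i(1 + 2^o + 2^(2o)) with o >= 2. *)

(** * Kruskal's theorem for binary trees *)

Section Subsequences.

Lemma increasing_lt (g : nat -> nat) :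
  (forall k, g k < g k.+1) -> forall i j, i < j -> g i < g j.
Proof.
move=> gS i; elim=> // j IHj; rewrite ltnS leq_eqVlt => /orP[/eqP->|/IHj] //.
by move=> h; apply: ltn_trans h (gS j).
Qed.

Lemma infinite_subseq (P : nat -> Prop) :
  (forall N, exists2 n, N <= n & P n) ->
  exists g : nat -> nat, (forall k, g k < g k.+1) /\ forall k, P (g k).
Proof.
move=> inf.
have /choice[h hP] : forall N, exists n, N <= n /\ P n.
  by move=> N; have [n] := inf N; exists n.
exists (fun k => iter k (fun x => h x.+1) (h 0)).
split=> [k|[|k]] /=; first exact: (hP _).1.
  exact: (hP _).2.
exact: (hP _).2.
Qed.

Lemma infinite_pigeonhole (K : finType) (f : nat -> K) :
  exists (k : K) (g : nat -> nat),
    (forall i, g i < g i.+1) /\ forall i, f (g i) = k.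
Proof.
suff [k inf] : exists k, forall N, exists2 n, N <= n & f n = k.
  by exists k; apply: (infinite_subseq (P := fun n => f n = k)).
apply: contrapT => /forallNP no.
have /choice[b bP] : forall k, exists N, forall n, N <= n -> f n <> k.
  move=> k; have /existsNP[N NP] := no k.
  by exists N => n leNn fnk; apply: NP; exists n.
have := bP (f (\max_k b k)) (\max_k b k).
by move=> /(_ (leq_bigmax _)); apply.
Qed.

Variables (T : Type) (le : T -> T -> Prop).
Hypothesis le_trans : forall y x z, le x y -> le y z -> le x z.

(** If infinitely many entries had no later entry above them, they would form a subsequence without
    a good pair. So beyond some [N] every entry has a later one above it, and iterating this choice
    gives the chain. *)
Lemma ascending_subseq (a : nat -> T) :
  (forall g : nat -> nat, (forall k, g k < g k.+1) ->
     exists i j, i < j /\ le (a (g i)) (a (g j))) ->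
  exists g : nat -> nat, (forall k, g k < g k.+1) /\
    forall i j, i < j -> le (a (g i)) (a (g j)).
Proof.
move=> good.
have [inf|/existsNP[N NP]] :=
    EM (forall N, exists2 n, N <= n & forall m, n < m -> ~ le (a n) (a m)).
  have [g [gS gP]] := infinite_subseq inf.
  have [i [j [ij]]] := good g gS.
  by move/(gP i _ (increasing_lt gS ij)).
have /choice[h hP] : forall n, exists m, N <= n -> n < m /\ le (a n) (a m).
  move=> n; have [leNn|/negP ?] := boolP (N <= n); last by exists 0.
  apply: contrapT => /forallNP no; apply: NP; exists n => // m nm le_nm.
  by apply: (no m).
pose g k := iter k h N.
have gN k : N <= g k.
  by elim: k => //= k IHk; apply: leq_trans IHk (ltnW (hP _ IHk).1).
exists g; split=> [k|i]; first exact: (hP _ (gN k)).1.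
elim=> // j IHj; rewrite ltnS leq_eqVlt => /orP[/eqP->|/IHj le_ij].
  exact: (hP _ (gN j)).2.
exact: le_trans le_ij (hP _ (gN j)).2.
Qed.

End Subsequences.

Section Kruskal.
Variable X : finType.

(** A node stores its own label and the labels intended for its children, so that well-formed trees
    matched by [emb_node] have children with equal root labels. *)
Inductive tree := Leaf of X | Node of X & X & X & tree & tree.

Inductive emb : tree -> tree -> Prop :=
| emb_leaf x : emb (Leaf x) (Leaf x)
| emb_node x y z t1 t2 u1 u2 :
    emb t1 u1 -> emb t2 u2 -> emb (Node x y z t1 t2) (Node x y z u1 u2)
| emb_left t x y z u1 u2 : emb t u1 -> emb t (Node x y z u1 u2)
| emb_right t x y z u1 u2 : emb t u2 -> emb t (Node x y z u1 u2).

Lemma emb_trans u t v : emb t u -> emb u v -> emb t v.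
Proof.
move=> tu uv; elim: uv t tu => {u v} [x|x y z u1 u2 v1 v2 _ IH1 _ IH2||] t tu //.
- inversion tu; subst; first by apply: emb_node; [apply: IH1|apply: IH2].
    by apply: emb_left; apply: IH1.
  by apply: emb_right; apply: IH2.
- by move=> *; apply: emb_left; auto.
- by move=> *; apply: emb_right; auto.
Qed.

Fixpoint tsize (t : tree) : nat :=
  if t is Node _ _ _ t1 t2 then (tsize t1 + tsize t2).+1 else 0.

Definition bad (f : nat -> tree) := forall i j, i < j -> ~ emb (f i) (f j).

Definition agree n (f g : nat -> tree) := forall i, i < n -> f i = g i.

(** This is the minimal bad sequence of Nash-Williams. *)
Lemma minimal_bad_sequence f0 : bad f0 ->
  exists f, bad f /\
    forall n g, bad g -> agree n f g -> tsize (f n) <= tsize (g n).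
Proof.
move=> bad0.
(* Stage n improves a bad sequence at index n, keeping the earlier entries. *)
have /choice[step stepP] (nf : nat * {f | bad f}) : exists h : {f | bad f},
    agree nf.1 (sval nf.2) (sval h) /\
    forall g, bad g -> agree nf.1 (sval nf.2) g ->
      tsize (sval h nf.1) <= tsize (g nf.1).
  case: nf => n [f badf] /=.
  pose S m := `[< exists g, [/\ bad g, agree n f g & tsize (g n) = m] >].
  have exS : exists m, S m by exists (tsize (f n)); apply/asboolP; exists f.
  have [m /asboolP[g [badg fg <-]] min] := ex_minnP exS.
  exists (exist _ g badg); split=> // h badh fh.
  by apply: min; apply/asboolP; exists h.
pose F := fix F n := if n is m.+1 then step (m, F m) else exist _ f0 bad0.
have FS n : agree n (sval (F n)) (sval (F n.+1)) by have [] := stepP (n, F n).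
have F_agree n m : n <= m -> agree n (sval (F n)) (sval (F m)).
  elim: m => [|m IHm]; first by rewrite leqn0 => /eqP->.
  rewrite leq_eqVlt => /orP[/eqP-> //|]; rewrite ltnS => le_nm i lt_in.
  by rewrite (IHm le_nm) // (FS m) // (leq_trans lt_in).
(* Entry [n] no longer changes after stage [n.+1], so the diagonal collects the final values. *)
pose f n := sval (F n.+1) n.
have fE n m : n < m -> f n = sval (F m) n by move=> lt_nm; apply: F_agree lt_nm _ _.
exists f; split=> [i j lt_ij|n g badg fg].
  rewrite (fE i j.+1) ?ltnS 1?ltnW //; exact: (svalP (F j.+1)).
have [_ ] := stepP (n, F n); apply=> // i lt_in /=.
by rewrite -fE // fg.
Qed.

Definition child (t u : tree) :=
  if u is Node _ _ _ u1 u2 then t = u1 \/ t = u2 else False.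

Lemma child_size t u : child t u -> tsize t < tsize u.
Proof. by case: u => //= x y z u1 u2 [] ->; rewrite ltnS ?leq_addr ?leq_addl. Qed.

Lemma emb_child s t u : child t u -> emb s t -> emb s u.
Proof.
by case: u => //= x y z u1 u2 [] -> ?; [apply: emb_left | apply: emb_right].
Qed.

(** Let [m] be the least parent index used, at position [k]. If the children formed a bad sequence,
    those from [k] on could be spliced after the first [m] entries of [f]; the result would be bad
    and smaller at [m]. *)
Lemma children_good f : bad f ->
  (forall n g, bad g -> agree n f g -> tsize (f n) <= tsize (g n)) ->
  forall (c : nat -> tree) (h : nat -> nat), (forall k, child (c k) (f (h k))) ->
  exists i j, i < j /\ emb (c i) (c j).
Proof.
move=> badf minf c h ch; apply: contrapT => no.
have badc i j : i < j -> ~ emb (c i) (c j) by move=> ? ?; apply: no; exists i, j.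
have [m /asboolP[k hk] minm] :=
  ex_minnP (ex_intro (fun m => `[< exists k, h k = m >]) (h 0)
              (introT (asboolP _) (ex_intro _ 0 erefl))).
have {}minm l : m <= h l by apply: minm; apply/asboolP; exists l.
pose g i := if i < m then f i else c (k + (i - m)).
have badg : bad g.
  move=> i j lt_ij; rewrite /g; have [lt_jm|le_mj] := ltnP j m.
    by rewrite (ltn_trans lt_ij lt_jm); apply: badf.
  have [lt_im|le_mi] := ltnP i m; last by apply: badc; lia.
  by move/(emb_child (ch _)); apply: badf; apply: leq_trans lt_im (minm _).
have /(minf m g badg) : agree m f g by move=> i lt_im; rewrite /g lt_im.
rewrite /g ltnn subnn addn0 leqNgt -hk => /negP; apply.
exact: child_size.
Qed.

(** The pigeonhole principle fixes the root data. For nodes, a subsequence with ascending left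
    children is chosen first, then a good pair of right children inside it. *)
Theorem kruskal (f : nat -> tree) : exists i j, i < j /\ emb (f i) (f j).
Proof.
apply: contrapT => nof.
have /minimal_bad_sequence[{nof} {}f [badf minf]] : bad f.
  by move=> i j ? ?; apply: nof; exists i, j.
have good := children_good badf minf.
pose lab t : X + X * X * X :=
  match t with Leaf x => inl x | Node x y z _ _ => inr (x, y, z) end.
have [l [g [gS gl]]] := infinite_pigeonhole (lab \o f).
have {gS}g_lt := increasing_lt gS.
case: l gl => [x|[[x y] z]] gl.
  have leafE i : f (g i) = Leaf x.
    by have := gl i; rewrite /lab /=; case: (f (g i)) => // ? [->].
  by apply: (badf _ _ (g_lt 0 1 isT)); rewrite !leafE; apply: emb_leaf.
have /choice[ch chE] i : exists ch, f (g i) = Node x y z ch.1 ch.2.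
  have := gl i; rewrite /lab /=; case: (f (g i)) => // ? ? ? t1 t2 [-> -> ->].
  by exists (t1, t2).
have [h [hS h_asc]] : exists h : nat -> nat, (forall k, h k < h k.+1) /\
    forall i j, i < j -> emb (ch (h i)).1 (ch (h j)).1.
  apply: (ascending_subseq emb_trans (a := fun i => (ch i).1)) => h hS.
  by apply: (good _ (g \o h)) => k; rewrite /= chE /=; left.
have [i [j [lt_ij emb2]]] : exists i j, i < j /\ emb (ch (h i)).2 (ch (h j)).2.
  by apply: (good _ (g \o h)) => k; rewrite /= chE /=; right.
apply: (badf _ _ (g_lt _ _ (increasing_lt hS lt_ij))); rewrite !chE.
exact: emb_node (h_asc _ _ lt_ij) emb2.
Qed.

End Kruskal.

(** * Pumping in a prescribed direction *)

Section CommutativeGrammar.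
Variables (X : finType) (V : nmodType).
Variables (leaf : X -> Prop) (leaf_val : X -> V) (bin : X -> X -> X -> Prop).

(** A grammar in binary form whose words are recorded only by their values in a commutative
    monoid. *)
Inductive derives : X -> V -> Prop :=
| derives_leaf x : leaf x -> derives x (leaf_val x)
| derives_bin x y z v w :
    bin x y z -> derives y v -> derives z w -> derives x (v + w)%R.

Definition tree_root (t : tree X) :=
  match t with Leaf x => x | Node x _ _ _ _ => x end.

Fixpoint tree_val (t : tree X) : V :=
  match t with
  | Leaf x => leaf_val x
  | Node _ _ _ t1 t2 => (tree_val t1 + tree_val t2)%R
  end.

Fixpoint wf_tree (t : tree X) : Prop :=
  match t with
  | Leaf x => leaf x
  | Node x y z t1 t2 =>
    [/\ bin x y z, tree_root t1 = y, tree_root t2 = z, wf_tree t1 & wf_tree t2]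
  end.

Lemma derives_tree x v :
  derives x v -> exists t, [/\ wf_tree t, tree_root t = x & tree_val t = v].
Proof.
elim=> {x v} [x lx|x y z v w xyz _ [t [wt rt <-]] _ [u [wu ru <-]]].
  by exists (Leaf x).
by exists (Node x y z t u).
Qed.

Lemma tree_derives t : wf_tree t -> derives (tree_root t) (tree_val t).
Proof.
elim: t => [x|x y z t IHt u IHu] /=; first exact: derives_leaf.
case=> xyz rt ru /IHt; rewrite rt => dt /IHu; rewrite ru.
exact: derives_bin dt.
Qed.

Lemma derives_iter x v d : derives x v ->
  (forall w, derives x w -> derives x (w + d)%R) ->
  forall m, derives x (v + d *+ m)%R.
Proof.
move=> dv ctx; elim=> [|m IHm]; first by rewrite mulr0n addr0.
by rewrite mulrSr addrA; apply: ctx.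
Qed.

(* [e] is the value of the context around the copy of [t] inside [u]; [d] is
   the value inserted strictly inside that copy. *)
Lemma emb_pump t u : emb t u -> wf_tree t -> wf_tree u ->
  exists d e : V, [/\ tree_val u = (tree_val t + d + e)%R,
    forall m, derives (tree_root t) (tree_val t + d *+ m)%R &
    forall v, derives (tree_root t) v -> derives (tree_root u) (v + e)%R].
Proof.
elim=> {t u} [x|x y z t1 t2 u1 u2 _ IH1 _ IH2|t x y z u1 u2 _ IH
              |t x y z u1 u2 _ IH] /=.
- move=> lx _; exists 0%R, 0%R; split=> [|m|v]; rewrite ?addr0 //.
  by rewrite mul0rn addr0; apply: derives_leaf.
- case=> xyz rt1 rt2 wt1 wt2 [_ ru1 ru2 wu1 wu2].
  have [d1 [e1 [-> dm1]]] := IH1 wt1 wu1.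
  have [d2 [e2 [-> dm2]]] := IH2 wt2 wu2.
  rewrite rt1 rt2 ru1 ru2 in dm1 dm2 * => ctx2 ctx1.
  (* The contexts around the copies of the children lie inside the copy of the node, so they join
     the inserted value and the outer context is empty. *)
  exists (d1 + e1 + (d2 + e2))%R, 0%R; split=> [|m|v]; rewrite ?addr0 //.
    by rewrite -(addrA (tree_val t1)) -(addrA (tree_val t2)) addrACA.
  have -> : (tree_val t1 + tree_val t2 + (d1 + e1 + (d2 + e2)) *+ m =
     (tree_val t1 + d1 *+ m + e1 *+ m) + (tree_val t2 + d2 *+ m + e2 *+ m))%R.
    rewrite -[in RHS](addrA (tree_val t1)) -[in RHS](addrA (tree_val t2)).
    by rewrite [RHS]addrACA !mulrnDl.
  (* Matched children have equal root labels, so the contexts [e1] and [e2] can be iterated. *)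
  by apply: derives_bin xyz _ _; apply: derives_iter.
- move=> wt [xyz ru1 ru2 wu1 wu2]; have [d [e [-> dm ctx]]] := IH wt wu1.
  exists d, (e + tree_val u2)%R; split=> // [|v dv]; rewrite addrA //.
  apply: derives_bin xyz _ _; first by rewrite -ru1; apply: ctx.
  by rewrite -ru2; apply: tree_derives.
- move=> wt [xyz ru1 ru2 wu1 wu2]; have [d [e [-> dm ctx]]] := IH wt wu2.
  exists d, (e + tree_val u1)%R; split=> // [|v dv].
    by rewrite (addrA _ e) addrC.
  rewrite (addrA v) addrC.
  apply: derives_bin xyz _ _; last by rewrite -ru2; apply: ctx.
  by rewrite -ru1; apply: tree_derives.
Qed.

(** Kruskal's theorem is applied to derivation trees of the [f n]. All have root [x], so the outer
    context can be iterated along with the inner insertion. *)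
Theorem derives_arithmetic_progression x (f : nat -> V) :
  (forall n, derives x (f n)) ->
  exists i j e, [/\ i < j, f j = (f i + e)%R &
    forall m, derives x (f i + e *+ m)%R].
Proof.
move=> fD; have /choice[t tP] n := derives_tree (fD n).
have [i [j [lt_ij emb_ij]]] := kruskal t; exists i, j.
have [wi ri vi] := tP i; have [wj rj vj] := tP j.
have [d [e]] := emb_pump emb_ij wi wj; rewrite ri rj vi vj => -[-> dm ctx].
exists (d + e)%R; split=> // [|m]; rewrite ?addrA // mulrnDl addrA.
exact: derives_iter.
Qed.

End CommutativeGrammar.

(** * Context-free grammars weighted by an automaton *)

Section WeightedAutomaton.
Variables (Q : finType) (V : nmodType).
Variables (delta : Q -> bool -> Q) (wt : Q -> bool -> V).

Fixpoint run (q : Q) (w : seq bool) : Q :=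
  if w is b :: w' then run (delta q b) w' else q.

Fixpoint weight (q : Q) (w : seq bool) : V :=
  if w is b :: w' then (wt q b + weight (delta q b) w')%R else 0%R.

Lemma run_cat q u w : run q (u ++ w) = run (run q u) w.
Proof. by elim: u q => /=. Qed.

Lemma weight_cat q u w : weight q (u ++ w) = (weight q u + weight (run q u) w)%R.
Proof. by elim: u q => [|b u IHu] q /=; rewrite ?add0r // IHu addrA. Qed.

Variable G : cfg.
Implicit Types s : seq (nonterm G + bool).

(** Suffixes of right-hand sides bring the grammar into binary form: an item splits into its first
    symbol and the remaining suffix. The empty item and single terminals serve as leaves, the start
    symbol as root. *)
Definition items : seq (seq (nonterm G + bool)) :=
  [:: [::]; [:: inl (cfg_start G)]; [:: inr true]; [:: inr false]] ++
  [seq drop i r.2 | r <- cfg_rules G, i <- iota 0 (size r.2).+1].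

Lemma mem_items_drop A rhs i : (A, rhs) \in cfg_rules G -> drop i rhs \in items.
Proof.
move=> Ar; have [le_i|lt_i] := leqP i (size rhs); last first.
  by rewrite drop_oversize ?mem_head // ltnW.
rewrite mem_cat; apply/orP; right; apply/allpairsPdep.
by exists (A, rhs), i; rewrite mem_iota.
Qed.

Lemma mem_items_behead c s : c :: s \in items -> s \in items.
Proof.
rewrite mem_cat !inE => /orP[/or4P[] // /eqP[_ ->] //|].
case/allpairsPdep=> -[A rhs] [i [Ar _ /= /(congr1 behead)/= ->]].
by rewrite -drop1 drop_drop; apply: mem_items_drop Ar.
Qed.

(** The Bar-Hillel triple construction: an item with the automaton states before and after it. *)
Definition annotated_item : finType := (seq_sub items * Q * Q)%type.

Definition item_leaf (x : annotated_item) : Prop :=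
  match val x.1.1 with
  | [::] => x.2 = x.1.2
  | [:: inr b] => x.2 = delta x.1.2 b
  | _ => False
  end.

Definition item_val (x : annotated_item) : V :=
  if val x.1.1 is inr b :: _ then wt x.1.2 b else 0%R.

Definition item_bin (x y z : annotated_item) : Prop :=
  [/\ y.1.2 = x.1.2, z.1.2 = y.2, z.2 = x.2 &
   match val x.1.1 with
   | [::] => False
   | inr b :: s => val y.1.1 = [:: inr b] /\ val z.1.1 = s
   | inl A :: s => (A, val y.1.1) \in cfg_rules G /\ val z.1.1 = s
   end].

Scheme gen_ind2 := Induction for gen Sort Prop
with gen_seq_ind2 := Induction for gen_seq Sort Prop.

Lemma derives_gen x v : derives item_leaf item_val item_bin x v ->
  exists w, [/\ gen_seq G (val x.1.1) w, run x.1.2 w = x.2 & weight x.1.2 w = v].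
Proof.
elim=> {x v} [[[s q] q']|[[s q] q'] [[s1 q1] q1'] [[s2 q2] q2'] v1 v2].
  rewrite /item_leaf /item_val /=; case: (val s) => [|[A //|b] [|//]] /= ->.
    by exists [::]; split=> //; apply: gen_nil.
  by exists [:: b]; rewrite /= addr0; split=> //; apply: gen_term; apply: gen_nil.
rewrite /item_bin /= => -[-> -> -> sE] _ [w1 [gw1 rw1 <-]] _ [w2 [gw2 rw2 <-]].
exists (w1 ++ w2); rewrite run_cat weight_cat rw1; split=> //.
case: (val s) sE => [//|[A|b] s'] [h1 h2]; rewrite h2 in gw2.
  by apply: gen_nonterm gw2; apply: gen_rule h1 gw1.
rewrite h1 in gw1; inversion gw1 as [|? ? w3 gw3|]; subst.
by inversion gw3; subst; apply: gen_term.
Qed.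

Lemma gen_derives s w : gen_seq G s w -> forall (sP : s \in items) q,
  derives item_leaf item_val item_bin (SeqSub sP, q, run q w) (weight q w).
Proof.
(* A lone nonterminal need not be an item, so the claim for [gen] is made about the right-hand side
   of the rule applied to it. *)
move: s w; apply: (@gen_seq_ind2 G (fun A w _ => exists2 rhs,
  (A, rhs) \in cfg_rules G & forall (sP : rhs \in items) q,
  derives item_leaf item_val item_bin (SeqSub sP, q, run q w) (weight q w))).
- by move=> A rhs w Ar _ IH; exists rhs.
- move=> sP q.
  exact: (@derives_leaf _ _ item_leaf item_val item_bin (SeqSub sP, q, q)).
- move=> b s w _ IH sP q /=.
  have bP : [:: inr b] \in items by case: b {IH sP}; rewrite !inE eqxx ?orbT.
  apply: (@derives_bin _ _ _ _ _ _ (SeqSub bP, q, delta q b)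
     (SeqSub (mem_items_behead sP), delta q b, run (delta q b) w)); last exact: IH.
    by split.
  exact: (@derives_leaf _ _ item_leaf item_val item_bin
            (SeqSub bP, q, delta q b)).
- move=> A s u w _ [rhs Ar IHu] _ IHw sP q; rewrite run_cat weight_cat.
  have rP : rhs \in items by rewrite -[rhs]drop0; apply: mem_items_drop Ar.
  apply: derives_bin (IHu rP q) (IHw (mem_items_behead sP) (run q u)).
  by split.
Qed.

(* Unlike the pumping lemma, this controls the direction of the pumped vector:
   it is a difference of two members of the given family. *)
Theorem context_free_arithmetic_progression (q0 qf : Q) (L : language)
    (f : nat -> V) :
  (forall w, L w <-> gen G (cfg_start G) w) ->
  (forall n, exists w, [/\ L w, run q0 w = qf & weight q0 w = f n]) ->
  exists i j e, [/\ i < j, f j = (f i + e)%R &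
    forall m, exists w, [/\ L w, run q0 w = qf & weight q0 w = (f i + e *+ m)%R]].
Proof.
move=> LG fL; have sP : [:: inl (cfg_start G)] \in items by rewrite !inE eqxx orbT.
have fD n : derives item_leaf item_val item_bin (SeqSub sP, q0, qf) (f n).
  have [w [/LG Lw <- <-]] := fL n; apply: gen_derives.
  by rewrite -[w]cats0; apply: gen_nonterm Lw _; apply: gen_nil.
have [i [j [e [lt_ij fj dm]]]] := derives_arithmetic_progression fD.
exists i, j, e; split=> // m; have [w [gw rw ww]] := derives_gen (dm m).
exists w; split=> //; apply/LG; move: gw => /=.
move=> gw; inversion gw as [| |A s u w' gu gw']; subst.
by inversion gw'; subst; rewrite cats0.
Qed.

End WeightedAutomaton.

(** The automaton becomes a right-linear grammar with the states as nonterminals; accepting states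
    derive the empty word. *)
Lemma regular_context_free (L : language) : regular L -> context_free L.
Proof.
case=> S [s0 [delta [F LE]]].
pose rules : seq (S * seq (S + bool)) :=
  [seq (s, [::]) | s <- enum S & F s] ++
  [seq (s, [:: inr b; inl (delta s b)]) | s <- enum S, b <- [:: true; false]].
pose G := CFG s0 rules.
have gen_inv s w : gen G s w -> (w = [::] /\ F s) \/
    exists b u, w = b :: u /\ gen G (delta s b) u.
  case=> A rhs {}w; rewrite mem_cat => /orP[/mapP[s']|/allpairsP[[s' b]]].
    rewrite mem_filter => /andP[Fs _] [-> ->] gw.
    by inversion gw; left.
  case=> _ _ /= [-> ->] gw; inversion gw as [|? ? u gu|]; subst.
  inversion gu as [| |? ? u1 u2 gu1 gu2]; subst.
  inversion gu2; subst; rewrite cats0.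
  by right; exists b, u1.
exists G => w; rewrite {}LE -[cfg_start G]/s0.
elim: w {1 2}s0 => [|b w IHw] s /=; split.
- move=> Fs; apply: (@gen_rule G s [::]); last exact: gen_nil.
  by rewrite mem_cat map_f // mem_filter Fs mem_enum.
- by case/gen_inv=> [[_]|[b [u []]]].
- move=> /IHw gw; apply: (@gen_rule G s [:: inr b; inl (delta s b)]).
    rewrite mem_cat; apply/orP; right; apply/allpairsP; exists (s, b).
    by rewrite mem_enum; case: (b).
  by apply: gen_term; rewrite -[w]cats0; apply: gen_nonterm gw _; apply: gen_nil.
- by case/gen_inv=> [[//]|[_ [_ [[<- <-] /IHw]]]].
Qed.

(** * Three-heap Nim *)

(* Nim-sum zero for three heaps, digit by digit; [fuel] bounds the number of
   binary digits that are inspected. *)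
Fixpoint nim_zero_upto (fuel a b c : nat) : bool :=
  if fuel is k.+1 then
    ~~ (odd a (+) odd b (+) odd c) && nim_zero_upto k a./2 b./2 c./2
  else true.

Definition nim_zero a b c := nim_zero_upto (a + b + c) a b c.

Lemma nim_zero_upto_stable k m a b c : a + b + c <= k -> a + b + c <= m ->
  nim_zero_upto k a b c = nim_zero_upto m a b c.
Proof.
elim: k m a b c => [|k IHk] [|m] a b c // le_k le_m.
- have [-> -> ->] : [/\ a = 0, b = 0 & c = 0] by split; lia.
  by elim: m.+1.
- have [-> -> ->] : [/\ a = 0, b = 0 & c = 0] by split; lia.
  by elim: k.+1.
- by rewrite /= (IHk m) //; lia.
Qed.

Lemma nim_zeroE a b c :
  nim_zero a b c = ~~ (odd a (+) odd b (+) odd c) && nim_zero a./2 b./2 c./2.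
Proof.
rewrite /nim_zero (@nim_zero_upto_stable _ (a + b + c).+1) //=.
by congr (_ && _); apply: nim_zero_upto_stable; lia.
Qed.

Lemma nim_zero_ind (P : nat -> nat -> nat -> Prop) : P 0 0 0 ->
  (forall a b c, 0 < a + b + c -> P a./2 b./2 c./2 -> P a b c) ->
  forall a b c, P a b c.
Proof.
move=> P0 PS a b c; move: {2}(a + b + c) (leqnn (a + b + c)) => k.
elim: k a b c => [|k IHk] a b c le_k; have [s0|s1] := posnP (a + b + c).
- by have [-> -> ->] : [/\ a = 0, b = 0 & c = 0] by split; lia.
- by lia.
- by have [-> -> ->] : [/\ a = 0, b = 0 & c = 0] by split; lia.
- by apply: PS s1 _; apply: IHk; lia.
Qed.

Lemma nim_zero_rot a b c : nim_zero a b c = nim_zero b c a.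
Proof.
move: a b c; apply: nim_zero_ind => // a b c _ IH.
rewrite nim_zeroE [RHS]nim_zeroE IH.
by case: (odd a); case: (odd b); case: (odd c).
Qed.

(** Two heaps determine the third digit by digit. Hence no Nim move leads from a zero position to a
    zero position. *)
Lemma nim_zero_inj a b c d : nim_zero a b c -> nim_zero a b d -> c = d.
Proof.
have : a + b + c + d <= a + b + c + d by [].
move: {2}(a + b + c + d) => k; elim: k a b c d => [|k IHk] a b c d le_k.
  by lia.
rewrite nim_zeroE => /andP[o1 z1]; rewrite nim_zeroE => /andP[o2 z2].
have [s0|s1] := posnP (a + b + c + d); first by lia.
by have := IHk _ _ _ _ _ z1 z2; lia.
Qed.

(** If the higher digits are balanced, an odd heap gives up its last digit. Otherwise a move for the
    halved heaps is lifted, the last digit of the changed heap being chosen to balance its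
    column. *)
Lemma nim_winning_move a b c : ~~ nim_zero a b c ->
  [\/ exists2 m, m < a & nim_zero m b c, exists2 m, m < b & nim_zero a m c
    | exists2 m, m < c & nim_zero a b m].
Proof.
move: a b c; apply: nim_zero_ind => // a b c _ IH.
rewrite nim_zeroE negb_and; have [z|nz _] := boolP (nim_zero a./2 b./2 c./2).
  rewrite orbF negbK => o.
  have pred_half x : odd x -> (x.-1 < x) /\ (x.-1./2 = x./2) by lia.
  have [oa|ob|oc] : [\/ odd a, odd b | odd c].
    by move: o; case: (odd a); case: (odd b); case: (odd c) => //= _; constructor.
  - have [lt_a ha] := pred_half _ oa; constructor 1; exists a.-1 => //.
    by rewrite nim_zeroE ha z andbT; lia.
  - have [lt_b hb] := pred_half _ ob; constructor 2; exists b.-1 => //.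
    by rewrite nim_zeroE hb z andbT; lia.
  - have [lt_c hc] := pred_half _ oc; constructor 3; exists c.-1 => //.
    by rewrite nim_zeroE hc z andbT; lia.
have odd_bit (x : bool) y : odd (x + y.*2) = x.
  by rewrite oddD odd_double addbF; case: x.
have lt_bit (x : bool) y m : m < y./2 -> x + m.*2 < y by case: x; lia.
have [[m /lt_bit lt_m z]|[m /lt_bit lt_m z]|[m /lt_bit lt_m z]] := IH nz.
- constructor 1; exists (odd b (+) odd c + m.*2) => //.
  rewrite nim_zeroE half_bit_double z odd_bit.
  by case: (odd b); case: (odd c).
- constructor 2; exists (odd a (+) odd c + m.*2) => //.
  rewrite nim_zeroE half_bit_double z odd_bit.
  by case: (odd a); case: (odd c).
- constructor 3; exists (odd a (+) odd b + m.*2) => //.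
  rewrite nim_zeroE half_bit_double z odd_bit.
  by case: (odd a); case: (odd b).
Qed.

(** * Nim positions on the line (n, 2n, 3n) *)

Lemma nim_zero_double a b c : nim_zero a.*2 b.*2 c.*2 = nim_zero a b c.
Proof. by rewrite nim_zeroE !odd_double !doubleK. Qed.

Lemma nim_zero_scale k a b c :
  nim_zero (2 ^ k * a) (2 ^ k * b) (2 ^ k * c) = nim_zero a b c.
Proof.
by elim: k => [|k IHk]; rewrite ?mul1n // !expnS -!mulnA !mul2n nim_zero_double.
Qed.

(** Here [c] is the sum of [a] and [b] without carries. *)
Lemma nim_zero_le a b c : nim_zero a b c -> c <= a + b.
Proof.
move: a b c; apply: nim_zero_ind => // a b c _ IH.
by rewrite nim_zeroE => /andP[o /IH]; lia.
Qed.

Lemma nim_zero_lt a b c : nim_zero a b c -> odd a -> odd b -> c < a + b.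
Proof. by rewrite nim_zeroE => /andP[o /nim_zero_le]; lia. Qed.

(* On this line, nim-sum zero means that the binary expansion of n has no two
   adjacent ones. *)
Definition line n := nim_zero n (2 * n) (3 * n).

Lemma line_scale k n : line (2 ^ k * n) = line n.
Proof. by rewrite /line -[RHS](nim_zero_scale k) !(mulnCA (2 ^ k)). Qed.

(** After one halving the first two heaps are both odd, so their carry forces the third strictly
    below their sum; but it equals that sum. *)
Lemma line_3mod4 n : n %% 4 = 3 -> ~~ line n.
Proof.
move=> n3; apply/negP; rewrite /line nim_zeroE => /andP[_ /nim_zero_lt].
by lia.
Qed.

(** The last two digit columns are (1, 0, 1) and (0, 1, 1), both balanced; removing them leaves (n,
    2n, 3n). *)
Lemma line_1mod4 n : line (1 + 4 * n) = line n.
Proof.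
rewrite /line nim_zeroE nim_zeroE.
have -> : odd (1 + 4 * n) (+) odd (2 * (1 + 4 * n)) (+) odd (3 * (1 + 4 * n))
  = false by lia.
have -> : (1 + 4 * n)./2 = 2 * n by lia.
have -> : (2 * (1 + 4 * n))./2 = 1 + 4 * n by lia.
have -> : (3 * (1 + 4 * n))./2 = 1 + 6 * n by lia.
have -> : odd (2 * n) (+) odd (1 + 4 * n) (+) odd (1 + 6 * n) = false by lia.
have -> : (2 * n)./2 = n by lia.
have -> : (1 + 4 * n)./2 = 2 * n by lia.
by have -> : (1 + 6 * n)./2 = 3 * n by lia.
Qed.

Lemma line_three_bits o : 2 <= o -> line (1 + 2 ^ o + 2 ^ (o + o)).
Proof.
move=> o2.
have E : 2 ^ o = 4 * 2 ^ (o - 2) by rewrite -(expnD 2 2) subnKC.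
have -> : 1 + 2 ^ o + 2 ^ (o + o) = 1 + 4 * (2 ^ (o - 2) * (1 + 2 ^ o)).
  by rewrite expnD; nia.
by rewrite line_1mod4 line_scale E line_1mod4 -[_ ^ _]muln1 line_scale.
Qed.

(** * Peg positions that play as Nim *)

Section Board.
Local Open Scope ring_scope.

(* Pegs at a, a + 1, a + 3, ..., a + 2n - 1: the peg at a can hop 1, ..., n
   times to the right, as a Nim heap of size n. *)
Definition heap (p : board) (lo hi a : int) (n : nat) :=
  [/\ lo < a, a + 2 * n%:Z <= hi & forall j, lo <= j -> j <= hi ->
   p j = (j == a) || [&& a < j, j < a + 2 * n%:Z & ((j - a) %% 2)%Z == 1]].

Definition dead (p : board) (lo hi : int) :=
  forall j, lo <= j -> j < hi -> p j -> p (j + 1) -> False.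

(** The dead case covers both an exhausted heap and what a leftward hop leaves behind. *)
Definition zone (p : board) (lo hi : int) (n : nat) :=
  (exists2 a, heap p lo hi a n & (0 < n)%N) \/ n = 0%N /\ dead p lo hi.

Lemma heap_hop p lo hi a n q : heap p lo hi a n.+1 ->
  (forall j, q j = (if j == a + 1 *+ 2 then true
                    else if (j == a) || (j == a + 1) then false else p j)) ->
  heap q lo hi (a + 2) n.
Proof.
case=> lo_a hi_a pE qE; split; [lia|lia|move=> j lo_j hi_j].
by rewrite qE pE // mulr2n; do !case: ifP; lia.
Qed.

Lemma heap0_dead p lo hi a : heap p lo hi a 0 -> dead p lo hi.
Proof.
by case=> lo_a hi_a pE j lo_j hi_j; rewrite !pE; lia.
Qed.

Lemma heap_zone p lo hi a n : heap p lo hi a n -> zone p lo hi n.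
Proof.
by case: n => [|n] hp; [right; split=> //; apply: heap0_dead hp | left; exists a].
Qed.

Lemma zone_hop p lo hi n i d q : zone p lo hi n ->
  ~~ p (lo - 1) -> ~~ p (hi + 1) -> lo <= i -> i <= hi -> hop p i d q ->
  [/\ lo <= i + d *+ 2, i + d *+ 2 <= hi,
      exists2 m, (m < n)%N & zone q lo hi m &
      forall j, (j < lo) || (hi < j) -> q j = p j].
Proof.
move=> zp plo phi lo_i hi_i [dE [pi [pid [pidd qE]]]].
have lo_id : lo <= i + d.
  rewrite leNgt; apply/negP => lt; have e : i + d = lo - 1 by lia.
  by rewrite e (negbTE plo) in pid.
have hi_id : i + d <= hi.
  rewrite leNgt; apply/negP => lt; have e : i + d = hi + 1 by lia.
  by rewrite e (negbTE phi) in pid.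
case: zp => [[a hp n_gt0]|[_ dp]]; last first.
  exfalso; case: dE => dE; subst d; first by apply: (dp i) => //; lia.
  by apply: (dp (i - 1)) => //; [lia|rewrite subrK].
case: n n_gt0 hp => // n _ hp; have [lo_a hi_a pE] := hp.
have := pi; have := pid; rewrite !pE // => pid' pi'.
(* The only adjacent pegs of a heap are at [a] and [a + 1]: the right hop shortens the heap by one,
   the left hop kills it. *)
have [[iE dE']|[iE dE']] : (i = a /\ d = 1) \/ (i = a + 1 /\ d = -1) by lia.
  subst i d; have hq := heap_hop hp qE; rewrite mulr2n; split=> [|||j out]; try lia.
    by exists n => //; apply: heap_zone hq.
  by rewrite qE mulr2n; do !case: ifP => //; lia.
subst i d; rewrite mulr2n; split=> [|||j out]; try lia.
  exists 0%N => //; right; split=> // j lo_j hi_j.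
  by rewrite !qE !pE ?mulr2n //; repeat (case: ifP => ?); lia.
by rewrite qE mulr2n; do !case: ifP => //; lia.
Qed.

Lemma zone_mhop p lo hi n i q : mhop p i q -> zone p lo hi n ->
  ~~ p (lo - 1) -> ~~ p (hi + 1) -> lo <= i -> i <= hi ->
  (exists2 m, (m < n)%N & zone q lo hi m) /\
  forall j, (j < lo) || (hi < j) -> q j = p j.
Proof.
move=> mv; elim: mv n => {p i q} [p i d q|p i d p' q] hp.
  by move=> n zp plo phi lo_i hi_i; have [] := zone_hop zp plo phi lo_i hi_i hp.
move=> _ IH n zp plo phi lo_i hi_i.
have [lo_i' hi_i' [m lt_mn zp'] p'E] := zone_hop zp plo phi lo_i hi_i hp.
have [||[m' lt_m' zq] qE] := IH m zp' _ _ lo_i' hi_i'.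
- by rewrite p'E //; lia.
- by rewrite p'E //; lia.
split=> [|j out]; first by exists m' => //; apply: ltn_trans lt_m' lt_mn.
by rewrite qE // p'E.
Qed.

Lemma heap_move p lo hi a n m : heap p lo hi a n -> (m < n)%N ->
  exists q, [/\ mhop p a q, zone q lo hi m &
    forall j, (j < lo) || (hi < j) -> q j = p j].
Proof.
elim: n p a => // n IHn p a hp; rewrite ltnS leq_eqVlt.
have [lo_a hi_a pE] := hp.
pose q : board := fun j => if j == a + 1 *+ 2 then true
  else if (j == a) || (j == a + 1) then false else p j.
have hq : heap q lo hi (a + 2) n by apply: heap_hop hp _.
have hop_q : hop p a 1 q.
  split; [by left|split; [|split; [|split]]] => //; rewrite pE ?mulr2n; lia.
have qE j : (j < lo) || (hi < j) -> q j = p j.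
  by move=> out; rewrite /q mulr2n; do !case: ifP => //; lia.
case/orP=> [/eqP->|lt_mn].
  by exists q; split=> //; [apply: mhop1 hop_q|apply: heap_zone hq].
have [r [mv zr rE]] := IHn _ _ hq lt_mn.
exists r; split=> // [|j out]; last by rewrite rE // qE.
exact: mhopS hop_q mv.
Qed.

Lemma zone_move p lo hi n m : zone p lo hi n -> (m < n)%N ->
  exists q, [/\ move p q, zone q lo hi m &
    forall j, (j < lo) || (hi < j) -> q j = p j].
Proof.
case=> [[a hp _]|[-> //]] lt_mn; have [q [mv zq qE]] := heap_move hp lt_mn.
by exists q; split=> //; exists a.
Qed.

Lemma zone_ext p q lo hi n : (forall j, lo <= j -> j <= hi -> q j = p j) ->
  zone p lo hi n -> zone q lo hi n.
Proof.
move=> qp [[a [lo_a hi_a pE] n0]|[-> dp]]; [left|right].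
  by exists a => //; split=> // j lo_j hi_j; rewrite qp // pE.
split=> // j lo_j hi_j; rewrite !qp; try lia; exact: dp.
Qed.

(** Descent: P-positions [p] and [q] joined by a move yield such a pair [r], [s] two moves later.
    The recursion is on the derivation of [Ppos p]. *)
Lemma Ppos_no_move p : Ppos p -> forall q, move p q -> ~ Ppos q.
Proof.
move: p; fix IH 2 => p Pp; destruct Pp as [p Hp] => q mv Pq.
destruct (Hp q mv) as [r [mr Pr]].
destruct Pq as [q Hq]; destruct (Hq r mr) as [s [ms Ps]].
exact: (IH r Pr s ms Ps).
Qed.

(** * Nim on three separated zones *)

Section ThreeHeaps.
Variables (lo1 hi1 lo2 hi2 lo3 hi3 : int).
Hypotheses (sep12 : hi1 + 1 < lo2) (le2 : lo2 <= hi2) (sep23 : hi2 + 1 < lo3).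

Definition in_zones (j : int) :=
  [|| (lo1 <= j) && (j <= hi1), (lo2 <= j) && (j <= hi2)
    | (lo3 <= j) && (j <= hi3)].

(** The sites separating the zones hold no peg, so no hop passes from one zone to another. *)
Definition heaps (p : board) (a b c : nat) :=
  [/\ zone p lo1 hi1 a, zone p lo2 hi2 b, zone p lo3 hi3 c &
      forall j, p j -> in_zones j].

Lemma in_zones_update (p q : board) (lo hi : int) :
  (forall j, p j -> in_zones j) ->
  (forall j, lo <= j -> j <= hi -> in_zones j) ->
  (forall j, (j < lo) || (hi < j) -> q j = p j) ->
  forall j, q j -> in_zones j.
Proof.
move=> sup w qE j; have [out|inn] := boolP ((j < lo) || (hi < j)).
  by rewrite qE //; apply: sup.
by move=> _; apply: w; lia.
Qed.

Lemma heaps_update1 p q a b c m : heaps p a b c -> zone q lo1 hi1 m ->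
  (forall j, (j < lo1) || (hi1 < j) -> q j = p j) -> heaps q m b c.
Proof.
case=> _ zb zc sup zq qE; split=> //.
- by apply: zone_ext zb => j ? ?; apply: qE; lia.
- by apply: zone_ext zc => j ? ?; apply: qE; lia.
- by apply: in_zones_update sup _ qE => j ? ?; rewrite /in_zones; lia.
Qed.

Lemma heaps_update2 p q a b c m : heaps p a b c -> zone q lo2 hi2 m ->
  (forall j, (j < lo2) || (hi2 < j) -> q j = p j) -> heaps q a m c.
Proof.
case=> za _ zc sup zq qE; split=> //.
- by apply: zone_ext za => j ? ?; apply: qE; lia.
- by apply: zone_ext zc => j ? ?; apply: qE; lia.
- by apply: in_zones_update sup _ qE => j ? ?; rewrite /in_zones; lia.
Qed.

Lemma heaps_update3 p q a b c m : heaps p a b c -> zone q lo3 hi3 m ->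
  (forall j, (j < lo3) || (hi3 < j) -> q j = p j) -> heaps q a b m.
Proof.
case=> za zb _ sup zq qE; split=> //.
- by apply: zone_ext za => j ? ?; apply: qE; lia.
- by apply: zone_ext zb => j ? ?; apply: qE; lia.
- by apply: in_zones_update sup _ qE => j ? ?; rewrite /in_zones; lia.
Qed.

Lemma heaps_move p a b c q : heaps p a b c -> move p q ->
  [\/ exists2 m, (m < a)%N & heaps q m b c,
      exists2 m, (m < b)%N & heaps q a m c
    | exists2 m, (m < c)%N & heaps q a b m].
Proof.
move=> hp [i mv]; have [za zb zc sup] := hp.
have pi : p i by case: (mv) => [? ? ? ? [_ []]|? ? ? ? ? [_ []]].
have hole j : ~~ in_zones j -> ~~ p j by apply: contra; apply: sup.
have /or3P[] := sup i pi => /andP[lo_i hi_i].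
- have [||[m lt_m zq] qE] := zone_mhop mv za _ _ lo_i hi_i;
    try by apply: hole; rewrite /in_zones; lia.
  by constructor 1; exists m => //; apply: heaps_update1 hp zq qE.
- have [||[m lt_m zq] qE] := zone_mhop mv zb _ _ lo_i hi_i;
    try by apply: hole; rewrite /in_zones; lia.
  by constructor 2; exists m => //; apply: heaps_update2 hp zq qE.
- have [||[m lt_m zq] qE] := zone_mhop mv zc _ _ lo_i hi_i;
    try by apply: hole; rewrite /in_zones; lia.
  by constructor 3; exists m => //; apply: heaps_update3 hp zq qE.
Qed.

Lemma heaps_winning_move p a b c : heaps p a b c -> ~~ nim_zero a b c ->
  exists q a' b' c', [/\ move p q, heaps q a' b' c', nim_zero a' b' c' &
    (a' + b' + c' < a + b + c)%N].
Proof.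
move=> hp /nim_winning_move; have [za zb zc _] := hp.
case=> -[m lt_m z].
- have [q [mv zq qE]] := zone_move za lt_m; exists q, m, b, c.
  by split=> //; [apply: heaps_update1 hp zq qE|lia].
- have [q [mv zq qE]] := zone_move zb lt_m; exists q, a, m, c.
  by split=> //; [apply: heaps_update2 hp zq qE|lia].
- have [q [mv zq qE]] := zone_move zc lt_m; exists q, a, b, m.
  by split=> //; [apply: heaps_update3 hp zq qE|lia].
Qed.

(** Induction on the total heap size: each move unbalances the heaps, since two of them determine
    the third, and the Nim reply balances them again. *)
Lemma heaps_Ppos p a b c : heaps p a b c -> nim_zero a b c -> Ppos p.
Proof.
move: {2}(a + b + c)%N (leqnn (a + b + c)) => k.
elim/ltn_ind: k p a b c => k IHk p a b c le_k hp z; constructor=> q mv.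
have [a' [b' [c' [hq lt_q nz]]]] : exists a' b' c',
    [/\ heaps q a' b' c', (a' + b' + c' < a + b + c)%N & ~~ nim_zero a' b' c'].
  have [[m lt_m hq]|[m lt_m hq]|[m lt_m hq]] := heaps_move hp mv.
  - exists m, b, c; split=> //; first by lia.
    apply/negP; rewrite nim_zero_rot => z'.
    by rewrite nim_zero_rot in z; have := nim_zero_inj z z'; lia.
  - exists a, m, c; split=> //; first by lia.
    apply/negP; rewrite -nim_zero_rot => z'.
    by rewrite -nim_zero_rot in z; have := nim_zero_inj z z'; lia.
  - exists a, b, m; split=> //; first by lia.
    by apply/negP => z'; have := nim_zero_inj z z'; lia.
have [r [x [y [u [mr hr zr lt_r]]]]] := heaps_winning_move hq nz.
by exists r; split=> //; apply: (IHk _ _ r x y u (leqnn _)) => //; lia.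
Qed.

Lemma heaps_PposE p a b c : heaps p a b c -> Ppos p <-> nim_zero a b c.
Proof.
move=> hp; split; last exact: heaps_Ppos.
move=> Pp; apply: contraT => /(heaps_winning_move hp)[q [x [y [u [mq hq zq _]]]]].
by case: (Ppos_no_move Pp mq); apply: heaps_Ppos hq zq.
Qed.

End ThreeHeaps.

End Board.

(** * The counting automaton and the theorem *)

Definition rep10 n : seq bool := flatten (nseq n [:: true; false]).

Definition word a b c : seq bool :=
  true :: rep10 a ++ [:: false, false, true & rep10 b ++
    [:: false, false, true & rep10 c]].

Lemma size_rep10 n : size (rep10 n) = 2 * n.
Proof. by elim: n => //= n ->; lia. Qed.

Lemma nth_rep10 n k : nth false (rep10 n) k = ~~ odd k && (k < 2 * n).
Proof.
elim: n k => [|n IHn] k; first by rewrite /= nth_nil; lia.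
by case: k => [|[|k]] //=; rewrite IHn; lia.
Qed.

Lemma nth_word a b c k : nth false (word a b c) k =
  [|| (k == 0) || odd k && (k < 2 * a),
      (k == 2 * a + 3) || [&& 2 * a + 3 < k, ~~ odd k & k < 2 * a + 3 + 2 * b]
    | (k == 2 * a + 3 + 2 * b + 3) || [&& 2 * a + 3 + 2 * b + 3 < k, odd k &
         k < 2 * a + 3 + 2 * b + 3 + 2 * c]].
Proof.
case: k => [|k] //=; rewrite nth_cat size_rep10 nth_rep10.
have [lt_k|le_k] := ltnP k (2 * a); first by lia.
case E: (k - 2 * a) => [|[|[|m]]] /=; try lia.
rewrite nth_cat size_rep10 nth_rep10.
have [lt_m|le_m] := ltnP m (2 * b); first by lia.
case E2: (m - 2 * b) => [|[|[|l]]] /=; try lia.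
by rewrite nth_rep10; lia.
Qed.

Section WordBoard.
Local Open Scope ring_scope.

Lemma Plang_word a b c : Plang (word a b c) <-> nim_zero a b c.
Proof.
(* Each zone runs from the landing site of the leftward hop, one before its first peg, to that of
   the last rightward hop; one hole remains between zones. *)
apply: (@heaps_PposE (-1) (2 * a)%N%:Z (2 * a + 2)%N%:Z (2 * a + 3 + 2 * b)%N%:Z
  (2 * a + 3 + 2 * b + 2)%N%:Z (2 * a + 3 + 2 * b + 3 + 2 * c)%N%:Z); try lia.
split.
- apply: (@heap_zone _ _ _ 0); split; [lia|lia|move=> [k|k] lo_k hi_k].
    by rewrite /board_of_word nth_word /=; lia.
  by rewrite /board_of_word; lia.
- apply: (@heap_zone _ _ _ (2 * a + 3)%N%:Z).
  split; [lia|lia|move=> [k|k] lo_k hi_k].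
    by rewrite /board_of_word nth_word /=; lia.
  by lia.
- apply: (@heap_zone _ _ _ (2 * a + 3 + 2 * b + 3)%N%:Z).
  split; [lia|lia|move=> [k|k] lo_k hi_k].
    by rewrite /board_of_word nth_word /=; lia.
  by lia.
- by case=> k //; rewrite /in_zones /board_of_word nth_word /=; lia.
Qed.

End WordBoard.

(* The automaton recognises the words [word a b c] and weighs them (a, b, c).
   [Some (h, s)] scans heap number [h] ([None], [Some false], [Some true] in
   order); [s] is (false, false) before its first peg, (false, true) in the loop
   10, (true, false) inside that loop, and (true, true) inside the separator. *)
Definition scan_state : finType := option (option bool * (bool * bool)).

Definition scan (q : scan_state) (x : bool) : scan_state :=
  match q, x with
  | Some (h, (false, false)), true => Some (h, (false, true))
  | Some (h, (false, true)), true => Some (h, (true, false))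
  | Some (h, (true, false)), false => Some (h, (false, true))
  | Some (Some true, (false, true)), false => None
  | Some (h, (false, true)), false => Some (h, (true, true))
  | Some (None, (true, true)), false => Some (Some false, (false, false))
  | Some (Some false, (true, true)), false => Some (Some true, (false, false))
  | _, _ => None
  end.

Definition unit_vector (h : option bool) : nat * nat * nat :=
  match h with
  | None => (1, 0, 0) | Some false => (0, 1, 0) | Some true => (0, 0, 1)
  end.

Definition scan_weight (q : scan_state) (x : bool) : nat * nat * nat :=
  if (q, x) is (Some (h, (false, true)), true) then unit_vector h else (0, 0, 0).

Definition scan_start : scan_state := Some (None, (false, false)).
Definition scan_final : scan_state := Some (Some true, (false, true)).

Lemma run_rep10 h n : run scan (Some (h, (false, true))) (rep10 n) =
  Some (h, (false, true)).
Proof. by elim: n => //= n IHn; case: h IHn => [[]|]. Qed.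

Lemma weight_rep10 h n :
  weight scan scan_weight (Some (h, (false, true))) (rep10 n) =
  (unit_vector h *+ n)%R.
Proof.
elim: n => [|n IHn] /=; first by rewrite mulr0n.
by rewrite mulrS -IHn; case: h {IHn} => [[]|]; congr (_ + _)%R; apply: add0r.
Qed.

Lemma triple_muln (a b c m : nat) :
  ((a, b, c) *+ m)%R = (a * m, b * m, c * m) :> nat * nat * nat.
Proof.
elim: m => [|m IHm]; first by rewrite mulr0n !muln0.
by rewrite mulrS IHm !mulnS.
Qed.

Lemma scan_word a b c : run scan scan_start (word a b c) = scan_final /\
  weight scan scan_weight scan_start (word a b c) = (a, b, c).
Proof.
rewrite /= !(run_cat, weight_cat) !(run_rep10, weight_rep10) /=.
rewrite !(run_cat, weight_cat) !(run_rep10, weight_rep10) /=.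
rewrite !(run_rep10, weight_rep10) !triple_muln; split=> //.
by rewrite !mul0n !mul1n; do !congr (_, _) => /=; lia.
Qed.

(** The only word, if any, that leads from [q] to [scan_final] with weight [v]. *)
Definition residual (q : scan_state) (v : nat * nat * nat) : seq bool :=
  let: (a, b, c) := v in
  let tail2 := [:: false, false, true & rep10 c] in
  let tail1 := [:: false, false, true & rep10 b ++ tail2] in
  if q is Some (h, s) then
    let: (n, tail) := match h with
      | None => (a, tail1) | Some false => (b, tail2) | Some true => (c, [::])
      end in
    match s with
    | (false, false) => true :: rep10 n ++ tail
    | (false, true) => rep10 n ++ tail
    | (true, false) => false :: rep10 n ++ tail
    | (true, true) => behead tail
    end
  else [::].

(** Heaps already passed contribute nothing to the weight still to be read. *)
Definition scanned_zero (q : scan_state) (v : nat * nat * nat) : bool :=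
  let: (a, b, c) := v in
  match q with
  | Some (None, (true, true)) => a == 0
  | Some (Some false, (true, true)) | Some (Some true, _) => (a == 0) && (b == 0)
  | Some (Some false, _) => a == 0
  | Some _ => true
  | None => false
  end.

Lemma run_residual q w : run scan q w = scan_final ->
  scanned_zero q (weight scan scan_weight q w) &&
  (w == residual q (weight scan scan_weight q w)).
Proof.
elim: w q => [|x w IHw] q; first by move=> /= ->.
move=> /= /IHw; case: (weight _ _ (scan q x) w) => [[a b] c] {IHw}.
by case: q => [[[[]|] [[] []]]|]; case: x => //=; rewrite ?andbF //;
  (try case/andP); (try case/andP); do ?[move/eqP->]; rewrite ?cats0 ?eqxx.
Qed.

Lemma scan_inv w a b c : run scan scan_start w = scan_final ->
  weight scan scan_weight scan_start w = (a, b, c) -> w = word a b c.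
Proof. by move=> /run_residual/andP[_ /eqP wE] vE; rewrite vE in wE. Qed.

(** The difference of two points of the line is a multiple of (1, 2, 3), so pumping stays on the
    line, and the automaton recovers each pumped word from its weight. *)
Lemma context_free_line (L : language) (f : nat -> nat) : context_free L ->
  (forall k, L (word (f k) (2 * f k) (3 * f k))) ->
  exists i j, i < j /\ forall m n, n = f i + (f j - f i) * m ->
    L (word n (2 * n) (3 * n)).
Proof.
case=> G LG Lf.
have [k|i [j [[[a b] c] [lt_ij [e1 e2 e3] pump]]]] :=
  @context_free_arithmetic_progression _ _ scan scan_weight G scan_start
    scan_final L (fun k => (f k, 2 * f k, 3 * f k)) LG.
  have [] := scan_word (f k) (2 * f k) (3 * f k).
  by eexists; split; first exact: Lf.
have {}e1 : f j = f i + a := e1.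
have {}e2 : 2 * f j = 2 * f i + b := e2.
have {}e3 : 3 * f j = 3 * f i + c := e3.
exists i, j; split=> // m n ->; have [w [Lw rw ww]] := pump m.
rewrite triple_muln in ww.
have wE : w = word (f i + a * m) (2 * f i + b * m) (3 * f i + c * m).
  exact: scan_inv rw ww.
have -> : f j - f i = a by lia.
have bE : b = 2 * a by lia.
have cE : c = 3 * a by lia.
by rewrite !mulnDr !mulnA -bE -cE -wE.
Qed.

(* The witness comes from 3 | 1 + x + x^2 and x^3 - 1 = (x - 1)(1 + x + x^2) for
   x = 4^c. *)
Lemma three_bits_mod c : 0 < c ->
  exists m, 3 + 3 * (4 ^ c - 1) * m = 1 + 2 ^ (6 * c) + 2 ^ (6 * c + 6 * c).
Proof.
move=> c_gt0.
have [x xE] : exists x, 4 ^ c = 1 + 3 * x.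
  elim: c {c_gt0} => [|c [x xE]]; first by exists 0.
  by exists (1 + 4 * x); rewrite expnS xE; lia.
have -> : 2 ^ (6 * c) = (1 + 3 * x) ^ 3.
  by rewrite -xE -expnM (_ : 6 * c = 2 * (c * 3)) ?expnM //; lia.
have -> : 2 ^ (6 * c + 6 * c) = (1 + 3 * x) ^ 6.
  by rewrite -xE -expnM (_ : 6 * c + 6 * c = 2 * (c * 6)) ?expnM //; lia.
pose y := 1 + 3 * x + 3 * x ^ 2.
exists (y + y * ((1 + 3 * x) ^ 3 + 1)); rewrite xE /y addKn.
by rewrite !expnS !expn0; ring.
Qed.

Theorem Plang_not_context_free : ~ context_free Plang.
Proof.
move=> cf; have [k|i [j [lt_ij /(_ 2 _ erefl)]]] :=
  context_free_line (f := fun k => 2 ^ k) cf.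
  by apply/Plang_word; rewrite -/(line _) -[2 ^ k]muln1 line_scale.
move/Plang_word; rewrite -/(line _).
(* Since i < j, the second factor ends in the binary digits 11. *)
have -> : 2 ^ i + (2 ^ j - 2 ^ i) * 2 = 2 ^ i * (2 ^ (j - i).+1 - 1).
  by rewrite -{1}(subnK (ltnW lt_ij)) expnD expnS; nia.
rewrite line_scale; apply/negP; apply: line_3mod4.
by rewrite -(subnSK lt_ij) !expnS; lia.
Qed.

Theorem Nlang_not_context_free : ~ context_free Nlang.
Proof.
move=> cf; have [k|i [j [lt_ij pump]]] :=
  context_free_line (f := fun k => 4 ^ k * 3) cf.
  move/Plang_word; apply/negP.
  by rewrite -/(line _) -(expnM 2 2) line_scale line_3mod4.
(* With this [m] the pumped value is 4^i(1 + 2^o + 2^(2o)) for o = 6(j - i), a point of the line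
   with Nim-sum zero. *)
have [|m mE] := @three_bits_mod (j - i); first by rewrite subn_gt0.
apply: (pump m _ erefl); apply/Plang_word; rewrite -/(line _).
have -> : 4 ^ i * 3 + (4 ^ j * 3 - 4 ^ i * 3) * m =
    4 ^ i * (3 + 3 * (4 ^ (j - i) - 1) * m).
  by rewrite -{1}(subnK (ltnW lt_ij)) expnD; nia.
rewrite mE -(expnM 2 2) line_scale; apply: line_three_bits; lia.
Qed.

Theorem theorem3 :
  ~ regular Plang /\ ~ regular Nlang /\
  ~ context_free Plang /\ ~ context_free Nlang.
Proof.
have nP := Plang_not_context_free; have nN := Nlang_not_context_free.
by split; [|split] => // /regular_context_free.
Qed.
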